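(* Let $G$ be a finite, simple, undirected, connected graph without isolated vertices, with type partition $\{V_1,\dots,V_t\}$ and corresponding type graph $H$. Let $ind(G)$ be the number of sets $V_i$ in the type partition that form an independent set. Then $$\chi_{CN}(G)\le \chi_{CN}(H)+\frac{ind(G)}{3}+3 .$$
   Context: A CFCN coloring (conflict-free coloring on closed neighborhoods) of a graph $G=(V,E)$ using $k$ colors is an assignment $C:V(G)\to\{1,\dots,k\}$ such that for every $v\in V(G)$ there exists $i\in\{1,\dots,k\}$ with $|N[v]\cap C^{-1}(i)|=1$, where $N[v]=N(v)\cup\{v\}$ is the closed neighborhood of $v$. $\chi_{CN}(G)$ is the smallest number of colors required for a CFCN coloring of $G$. Two vertices $v,w$ of $G$ have the same type if $N(v)\setminus\{w\}=N(w)\setminus\{v\}$. A type partition of $G$ is a partition of $V(G)$ into (nonempty) sets $V_1,\dots,V_t$ such that all the vertices in each $V_i$ have the same type. Each $V_i$ then forms a clique or an independent set, and for $i\ne j$ either every vertex of $V_i$ is adjacent to every vertex of $V_j$, or no vertex of $V_i$ is adjacent to any vertex of $V_j$. The type graph is $H=(\{1,\dots,t\},E_H)$ with $E_H=\{\{i,j\}:1\le i<j\le t,\ \text{each vertex of } V_i \text{ is a neighbor of each vertex of } V_j\}$. *)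

(* Defs.v *)
From mathcomp Require Import all_boot all_order all_algebra.
Set Implicit Arguments.
Unset Strict Implicit.
Unset Printing Implicit Defensive.

(* A finite graph is an adjacency relation e : rel T on a finType T; symmetry
   and irreflexivity are separate hypotheses. *)

Definition nbhd (T : finType) (e : rel T) (v : T) : {set T} := [set w | e v w].

Definition cl_nbhd (T : finType) (e : rel T) (v : T) : {set T} :=
  v |: nbhd e v.

Definition cfcn_coloring (T : finType) (e : rel T) (k : nat)
    (c : {ffun T -> 'I_k}) : bool :=
  [forall v : T, exists i : 'I_k, #|cl_nbhd e v :&: c @^-1: [set i]| == 1].

Definition cfcn_colorable (T : finType) (e : rel T) (k : nat) : bool :=
  [exists c : {ffun T -> 'I_k}, cfcn_coloring e c].

Lemma cfcn_colorable_ex (T : finType) (e : rel T) :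
  exists k, cfcn_colorable e k.
Proof.
exists #|T|; apply/existsP; exists [ffun x => enum_rank x].
apply/forallP => v; apply/existsP; exists (enum_rank v); apply/cards1P.
exists v; apply/setP => w; rewrite !inE ffunE (inj_eq enum_rank_inj).
by case: (w == v); rewrite ?andbF.
Qed.

Definition chi_CN (T : finType) (e : rel T) : nat :=
  ex_minn (cfcn_colorable_ex e).

Definition same_type (T : finType) (e : rel T) (v w : T) : bool :=
  nbhd e v :\ w == nbhd e w :\ v.

(* [partition] already forces the blocks to be nonempty; injectivity says that
   V lists each block once.  The partition need not be the coarsest one. *)
Definition type_partition (T : finType) (e : rel T) (t : nat)
    (V : 'I_t -> {set T}) : Prop :=
  [/\ injective V,
      partition [set V i | i : 'I_t] [set: T] &
      forall (i : 'I_t) (v w : T), v \in V i -> w \in V i -> same_type e v w].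

Definition type_graph (T : finType) (e : rel T) (t : nat)
    (V : 'I_t -> {set T}) : rel 'I_t :=
  fun i j => (i != j) && [forall x in V i, forall y in V j, e x y].

Definition independent (T : finType) (e : rel T) (A : {set T}) : bool :=
  [forall x in A, forall y in A, ~~ e x y].

(* A singleton block is independent, hence is counted. *)
Definition ind (T : finType) (e : rel T) (t : nat)
    (V : 'I_t -> {set T}) : nat :=
  #|[set i : 'I_t | independent e (V i)]|.

(* Main.v *)
Require Import Defs.
From mathcomp Require Import all_boot all_order all_algebra.
From mathcomp Require Import zify lra.
Set Implicit Arguments.
Unset Strict Implicit.
Unset Printing Implicit Defensive.
Import Order.TTheory GRing.Theory Num.Theory.
Local Open Scope ring_scope.

(* Fix a representative in each block and an optimal coloring of H.  Among the
   independent blocks choose greedily a set D with 3 |D| <= ind(G) such that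
   the independent blocks with no neighbor in D induce a bipartite subgraph
   of H.  Representatives inherit the color of their block in H, except that
   those of the blocks in D get pairwise distinct fresh colors.  The other
   vertices of the undominated independent blocks get two further colors, by
   the bipartition, and all remaining vertices one last color.  A fresh color
   satisfies the whole closed neighborhood of its vertex.  Elsewhere, a
   representative or a vertex of a clique block sees exactly the
   representatives of its closed neighborhood in H, and any other vertex of an
   independent block is the only one of its color in its closed neighborhood. *)

(** The color is named by the vertex that carries it. Colors lie in any [eqType], so that a sum type
    can keep several palettes apart. *)
Definition conflict_free (T : finType) (e : rel T) (K : eqType) (c : T -> K)
    (v : T) : Prop :=
  exists2 w, w \in cl_nbhd e v &
    forall u, u \in cl_nbhd e v -> c u = c w -> u = w.

Lemma cfcn_coloringP (T : finType) (e : rel T) (k : nat) (c : {ffun T -> 'I_k}) :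
  reflect (forall v, conflict_free e c v) (cfcn_coloring e c).
Proof.
apply: (iffP forallP) => cf v.
  have /existsP[i /cards1P[w Ew]] := cf v.
  have: w \in [set w] by rewrite inE.
  rewrite -Ew in_setI => /andP[vw]; rewrite !inE => /eqP cw.
  exists w => // u vu cu; apply/set1P; rewrite -Ew.
  by rewrite in_setI vu !inE cu cw /=.
have [w vw uniq_w] := cf v; apply/existsP; exists (c w); apply/cards1P.
exists w; apply/setP => u; rewrite in_set1 in_setI !inE.
apply/andP/eqP => [[vu /eqP cu]|->].
  by apply: uniq_w => //; rewrite !inE.
by split=> //; move: vw; rewrite !inE.
Qed.

Lemma chi_CN_le (T : finType) (e : rel T) (K : finType) (c : T -> K) :
  (forall v, conflict_free e c v) -> (chi_CN e <= #|K|)%N.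
Proof.
move=> cf; rewrite /chi_CN; case: ex_minnP => m _; apply.
apply/existsP; exists [ffun v => enum_rank (c v)]; apply/cfcn_coloringP => v.
have [w vw uniq_w] := cf v; exists w => // u vu.
by rewrite !ffunE => /enum_rank_inj; apply: uniq_w.
Qed.

Lemma chi_CN_coloring (T : finType) (e : rel T) :
  exists c : {ffun T -> 'I_(chi_CN e)}, forall v, conflict_free e c v.
Proof.
rewrite /chi_CN; case: ex_minnP => m /existsP[c /cfcn_coloringP cf] _.
by exists c.
Qed.

(** Induction on the size of [B]. A vertex [i] with at least two neighbors in [B] joins [D];
    deleting it with its neighbors removes at least three vertices, which pays for it. Otherwise [i]
    is deleted alone and then placed on the side opposite to its only possible neighbor. *)
Lemma bipartite_undominated (T : finType) (e : rel T) (B : {set T}) :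
    symmetric e -> irreflexive e ->
  exists D : {set T}, exists2 f : T -> bool, (3 * #|D| <= #|B|)%N &
    forall x y, x \in B -> y \in B ->
      (forall d, d \in D -> ~~ e d x) -> (forall d, d \in D -> ~~ e d y) ->
      e x y -> f x != f y.
Proof.
move=> e_sym e_irr; have [n] := ubnP #|B|; elim: n B => // n IHn B ltB.
have [->|[i iB]] := set_0Vmem B.
  by exists set0; exists xpredT => [|x y]; rewrite ?cards0 ?inE.
pose N := [set y in B | e i y].
have iN : i \notin N by rewrite inE e_irr andbF.
have [lt1N|leN1] := ltnP 1 #|N|.
- have sNB : i |: N \subset B.
    by apply/subsetP=> y; rewrite !inE => /predU1P[->|/andP[]].
  have cN : #|i |: N| = #|N|.+1 by rewrite cardsU1 iN.
  have cB := cardsD B (i |: N); rewrite (setIidPr sNB) in cB.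
  have lB := subset_leq_card sNB.
  have [|D [f leD fP]] := IHn (B :\: (i |: N)); first by lia.
  exists (i |: D), f; first by rewrite cardsU1; case: (i \in D) => /=; lia.
  move=> x y xB yB xD yD exy.
  have nix : ~~ e i x by apply: xD; rewrite setU11.
  have niy : ~~ e i y by apply: yD; rewrite setU11.
  (* Both ends survive the deletion: being undominated they avoid [N], and if one were [i], the edge
     [e x y] would make [i] dominate the other. *)
  apply: fP => //.
  + rewrite !inE negb_or xB (negbTE nix) andbF !andbT.
    by apply: contraNneq niy => <-.
  + rewrite !inE negb_or yB (negbTE niy) andbF !andbT.
    by apply: contraNneq nix => <-; rewrite e_sym.
  + by move=> d dD; apply: xD; rewrite setU1r.
  + by move=> d dD; apply: yD; rewrite setU1r.
- have cB := cardsD1 i B; rewrite iB in cB.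
  have [|D [f leD fP]] := IHn (B :\ i); first by lia.
  (* The value [true] is arbitrary: without a neighbor in [B], either side suits [i]. *)
  pose b := if [pick j in N] is Some j then ~~ f j else true.
  have bP y : y \in N -> b != f y.
    move=> yN; rewrite /b; case: pickP => [j jN|/(_ y)]; last by rewrite yN.
    by have /card_le1_eqP/(_ j y jN yN)-> := leN1; case: (f j).
  exists D, (fun x => if x == i then b else f x); first by lia.
  move=> x y xB yB xD yD.
  have [->|xi] := eqVneq x i; have [->|yi] := eqVneq y i; rewrite ?e_irr // => exy.
  + by apply: bP; rewrite inE yB.
  + by rewrite eq_sym; apply: bP; rewrite inE xB e_sym.
  + by apply: fP; rewrite // !inE ?xi ?yi.
Qed.

(** Turns the blocks into the fibers of a map [k], with [r] choosing a representative in each. *)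
Lemma type_partition_block (T : finType) (e : rel T) (t : nat)
    (V : 'I_t -> {set T}) :
    type_partition e V ->
  exists (k : T -> 'I_t) (r : 'I_t -> T),
    (forall v i, (v \in V i) = (k v == i)) /\ cancel r k.
Proof.
case=> V_inj /and3P[/eqP covV triV V0] _.
have ex_block v : exists i, v \in V i.
  have: v \in cover [set V i | i : 'I_t] by rewrite covV.
  by case/bigcupP=> _ /imsetP[i _ ->]; exists i.
have kP v i : (v \in V i) = (xchoose (ex_block v) == i).
  have vk := xchooseP (ex_block v); apply/idP/eqP => [vi|<- //].
  (* Disjointness only shows that the two blocks are equal as sets; injectivity of [V] then
     identifies their indices. *)
  apply: V_inj; apply/eqP; apply: contraTT triV => neqV.
  apply/trivIsetP=> /(_ _ _ (imset_f V isT) (imset_f V isT) neqV) /pred0P /(_ v).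
  by rewrite /= vk vi.
have ex_rep i : exists v, v \in V i.
  by apply/set0Pn; apply: contraNneq V0 => <-; apply: imset_f.
exists (fun v => xchoose (ex_block v)), (fun i => xchoose (ex_rep i)).
by split=> // i; apply/eqP; rewrite -kP (xchooseP (ex_rep i)).
Qed.

Lemma type_graph_sym (T : finType) (e : rel T) (t : nat) (V : 'I_t -> {set T}) :
  symmetric e -> symmetric (type_graph e V).
Proof.
move=> e_sym i j; rewrite /type_graph eq_sym; congr (_ && _).
by apply/idP/idP=> /forall_inP h; apply/forall_inP=> x xV;
  apply/forall_inP=> y yV; rewrite e_sym; have /forall_inP := h y yV; apply.
Qed.

Lemma same_type_adj (T : finType) (e : rel T) (v w u : T) :
  same_type e v w -> u != v -> u != w -> e v u = e w u.
Proof. by move=> /eqP/setP/(_ u) + uv uw; rewrite !inE uv uw. Qed.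

(** A single edge between two blocks yields all the others: its ends are replaced one at a time by
    vertices of the same type. *)
Lemma type_graphE (T : finType) (e : rel T) (t : nat) (V : 'I_t -> {set T})
    (k : T -> 'I_t) :
    symmetric e -> type_partition e V ->
    (forall v i, (v \in V i) = (k v == i)) ->
  forall v w, k v != k w -> type_graph e V (k v) (k w) = e v w.
Proof.
move=> e_sym [_ _ V_same] kP v w neq_k; rewrite /type_graph neq_k /=.
apply/forall_inP/idP => [h|evw x].
  by have /forall_inP/(_ w) := h v ltac:(by rewrite kP); apply; rewrite kP.
rewrite kP => /eqP kx; apply/forall_inP => y; rewrite kP => /eqP ky.
have neqk a b : k a != k b -> a != b by apply: contra_neq => ->.
have sx : same_type e x v by apply: (V_same (k v)); rewrite kP ?kx.
have sy : same_type e y w by apply: (V_same (k w)); rewrite kP ?ky.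
rewrite (same_type_adj sx); [|by apply: neqk; rewrite ?kx ky eq_sym..].
rewrite e_sym (same_type_adj sy); [|by apply: neqk; rewrite ?ky..].
by rewrite e_sym.
Qed.

(** One edge [x y] inside the block is moved to any pair by exchanging one end at a time, as
    [spread] does. *)
Lemma not_independent_clique (T : finType) (e : rel T) (A : {set T}) :
    symmetric e -> irreflexive e ->
    (forall v w, v \in A -> w \in A -> same_type e v w) ->
    ~~ independent e A ->
  forall v w, v \in A -> w \in A -> v != w -> e v w.
Proof.
move=> e_sym e_irr A_same.
rewrite negb_forall_in => /exists_inP[x xA]; rewrite negb_forall_in.
case/exists_inP=> y yA; rewrite negbK => exy.
have spread u z w : u \in A -> z \in A -> w \in A -> e u z -> u != w -> e u w.
  move=> uA zA wA euz neq_uw; rewrite e_sym -(same_type_adj (A_same z w zA wA)) //.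
    by rewrite e_sym.
  by apply: contraTneq euz => ->; rewrite e_irr.
move=> v w vA wA; have [->|neq_vx] := eqVneq v x; first exact: (spread x y).
by apply: (spread v x) => //; rewrite e_sym; apply: (spread x y); rewrite // eq_sym.
Qed.

Lemma chi_CN_type_graph (T : finType) (e : rel T) (t : nat)
    (V : 'I_t -> {set T}) :
    symmetric e -> irreflexive e -> type_partition e V ->
  exists2 d : nat, (3 * d <= ind e V)%N &
    (chi_CN e <= chi_CN (type_graph e V) + 3 + d)%N.
Proof.
move=> e_sym e_irr V_type; have [k [r [kP rK]]] := type_partition_block V_type.
have adjE := type_graphE e_sym V_type kP.
set h := type_graph e V in adjE *.
have h_sym : symmetric h by apply: type_graph_sym.
have h_irr : irreflexive h by move=> i; rewrite /h /type_graph eqxx.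
have [cH cHP] := chi_CN_coloring h.
have [D [f leD fP]] :=
  bipartite_undominated [set i | independent e (V i)] h_sym h_irr.
exists #|D| => //.
pose undom i := [forall d in D, ~~ h d i].
(* The summand [option bool] provides the constant 3: two sides of the bipartition and the leftover
   color [None]. *)
pose c (v : T) : 'I_(chi_CN h) + option bool + {i | i \in D} :=
  if v == r (k v) then
    if insub (k v) is Some d then inr d else inl (inl (cH (k v)))
  else inl (inr (if independent e (V (k v)) && undom (k v)
                 then Some (f (k v)) else None)).
have -> : (chi_CN h + 3 + #|D| =
           #|{: 'I_(chi_CN h) + option bool + {i | i \in D}}|)%N.
  by rewrite !card_sum card_ord card_option card_bool card_sig.
apply: (@chi_CN_le _ _ _ c) => v.
have inN u w : (w \in cl_nbhd e u) = (w == u) || e u w by rewrite !inE.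
have inNh i j : (j \in cl_nbhd h i) = (j == i) || h i j by rewrite !inE.
have c_nonrep w : w != r (k w) -> forall i, i \notin D -> c w <> c (r i).
  move=> neq_w i iD; rewrite /c (negbTE neq_w) rK eqxx.
  by rewrite insubF //; apply: negbTE.
have c_fresh i w : i \in D -> c w = c (r i) -> w = r i.
  move=> iD; rewrite /c rK eqxx (insubT (fun i => i \in D) iD).
  have [w_rep|//] := w =P r (k w); have [kD|/negbTE kD] := boolP (k w \in D).
    by rewrite (insubT (fun i => i \in D) kD) => -[<-].
  by rewrite insubF.
have c_rep i j : i \notin D -> j \notin D -> c (r i) = c (r j) -> cH i = cH j.
  move=> /negbTE iD /negbTE jD; rewrite /c !rK !eqxx.
  by rewrite !insubF // => -[].
(* If a block [d] of [D] is adjacent to that of [v], the fresh color of [r d] serves [v]. *)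
have [dom_v|] := boolP (undom (k v)); last first.
  rewrite negb_forall_in => /exists_inP[d dD]; rewrite negbK => hd.
  exists (r d); last by move=> u _; apply: c_fresh.
  rewrite inN -adjE rK; first by rewrite h_sym hd orbT.
  by apply: contraTneq hd => ->; rewrite h_irr.
have [/andP[v_nonrep indep_v]|] :=
  boolP ((v != r (k v)) && independent e (V (k v))).
  exists v; first by rewrite inN eqxx.
  move=> u; rewrite inN => /predU1P[//|evu].
  rewrite /c (negbTE v_nonrep) indep_v dom_v /=.
  case: ifP => [_|_]; first by case: insub.
  case: ifP => // /andP[indep_u dom_u] [] eq_f.
  (* A neighbor with the color of [v] lies in another block, since that of [v] is independent; the
     two blocks are then adjacent in [h] and on the same side, against [fP]. *)
  have neq_k : k v != k u.
    apply: contraTneq evu => eq_k.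
    have /forall_inP/(_ v) := indep_v; rewrite kP eqxx => /(_ isT).
    by move/forall_inP/(_ u); apply; rewrite kP eq_k.
  have := fP (k v) (k u); rewrite !inE indep_v indep_u adjE // eq_f eqxx.
  by move=> /(_ isT isT (forall_inP dom_v) (forall_inP dom_u) evu).
rewrite negb_and negbK => v_rep_or_clique.
have sees_reps i : (r i \in cl_nbhd e v) = (i \in cl_nbhd h (k v)).
  rewrite inN inNh; have [->|neq_i] := eqVneq i (k v).
    have [->//|neq_v] := eqVneq (r (k v)) v.
    move: v_rep_or_clique; rewrite eq_sym (negbTE neq_v) /= => clique_v.
    case: V_type => _ _ V_same.
    apply: (not_independent_clique e_sym e_irr (V_same (k v)) clique_v).
    + by rewrite kP.
    + by rewrite kP rK.
    + by rewrite eq_sym.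
  rewrite -adjE rK 1?eq_sym //; have [rv|//] := eqVneq (r i) v.
  by rewrite -rv rK eqxx in neq_i.
have [kD|kD] := boolP (k v \in D).
  exists (r (k v)); first by rewrite sees_reps inNh eqxx.
  by move=> u _; apply: c_fresh.
(* Hence every representative seen by [v] keeps its color from [cH], and the conflict-free color at
   [k v] carries over. *)
have nbD i : i \in cl_nbhd h (k v) -> i \notin D.
  rewrite inNh => /predU1P[->//|hi]; apply: contraL hi => iD.
  by rewrite h_sym; apply: (forall_inP dom_v).
have [j jN uniq_j] := cHP (k v); exists (r j); first by rewrite sees_reps.
move=> u uN eq_c; have [u_rep|neq_u] := eqVneq u (r (k u)); last first.
  by case: (c_nonrep u neq_u j (nbD j jN)).
rewrite u_rep sees_reps in uN; rewrite u_rep in eq_c *.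
by rewrite (uniq_j (k u)) //; apply: c_rep eq_c; apply: nbD.
Qed.

Theorem theorem14 (T : finType) (e : rel T)
    (e_sym : symmetric e) (e_irr : irreflexive e)
    (e_conn : forall x y : T, connect e x y)
    (e_noisol : forall x : T, exists y : T, e x y)
    (t : nat) (V : 'I_t -> {set T}) (V_type : type_partition e V) :
  ((chi_CN e)%:R : rat)
    <= (chi_CN (type_graph e V))%:R + (ind e V)%:R / 3%:R + 3%:R.
Proof.
have [d] := chi_CN_type_graph e_sym e_irr V_type.
rewrite -(ler_nat rat) natrM => le_d; rewrite -(ler_nat rat) !natrD => le_chi.
lra.
Qed.
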